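(* Let $\boldsymbol{S}=\{S_1,S_2\}\subset\mathbb{R}^{3\times3}$ be such that there exists a symmetric positive-definite matrix $P\in\mathbb{R}^{3\times 3}$ with $P-S_k^TPS_k\ge0$ for $k=1,2$. Then $\boldsymbol{S}$ is absolutely stable if and only if $\rho(A)<1$ for all $A\in\{S_1,S_2\}^\ell$, for $\ell=1,2,3,4,5,6$, and $8$.
   Context: $\rho(A)$ is the spectral radius of $A$; for a symmetric matrix $A$, $A\ge0$ means $x^TAx\ge0$ for all $x$. $\{S_1,S_2\}^\ell$ denotes the set of all products $S_{w_\ell}\cdots S_{w_1}$ with $(w_1,\dots,w_\ell)\in\{1,2\}^\ell$. $\boldsymbol{S}$ is absolutely stable if $\|S_{\sigma_n}\cdots S_{\sigma_1}\|\to0$ as $n\to+\infty$ for every sequence $\sigma=(\sigma_n)_{n\ge1}$ in $\{1,2\}$ (for any, equivalently every, matrix norm). *)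

(* Defs.v *)
From mathcomp Require Import all_boot all_order all_algebra.
From mathcomp Require Import all_classical all_reals all_analysis.
From mathcomp Require Import complex.

Set Implicit Arguments.
Unset Strict Implicit.
Unset Printing Implicit Defensive.

Import Order.TTheory GRing.Theory Num.Theory.
Import numFieldNormedType.Exports.

Local Open Scope classical_set_scope.
Local Open Scope ring_scope.

Definition psdmx (R : realType) (n : nat) (A : 'M[R]_n) : Prop :=
  forall x : 'cV[R]_n, 0 <= (x^T *m A *m x) ord0 ord0.

Definition posdefmx (R : realType) (n : nat) (A : 'M[R]_n) : Prop :=
  A^T = A /\ forall x : 'cV[R]_n, x != 0 -> 0 < (x^T *m A *m x) ord0 ord0.

(* [eigenvalue] uses row eigenvectors, which gives the same eigenvalues as
   column ones; since the spectrum is finite, the supremum is a maximum (and it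
   is 0 when n = 0). *)
Definition spectral_radius (R : realType) (n : nat) (A : 'M[R]_n) : R :=
  sup [set ComplexField.Normc.normc z | z in
         [set z : R[i] | eigenvalue (map_mx (real_complex R) A) z]].

(* For w = [:: w_1; ...; w_l] this is S w_l *m ... *m S w_1. *)
Definition word_prod (R : realType) (n : nat) (I : Type) (S : I -> 'M[R]_n)
    (w : seq I) : 'M[R]_n :=
  foldl (fun B i => S i *m B) 1%:M w.

Definition products (R : realType) (n : nat) (I : Type) (S : I -> 'M[R]_n)
    (l : nat) : set 'M[R]_n :=
  [set word_prod S w | w in [set: l.-tuple I]].

(* A switching sequence is indexed from 0: [sigma k] stands for sigma_(k+1).
   The norm is the library's entrywise maximum norm; in finite dimension all
   norms give the same notion. *)
Definition absolutely_stable (R : realType) (n : nat) (I : Type)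
    (S : I -> 'M[R]_n) : Prop :=
  forall sigma : nat -> I,
    (fun m => `|word_prod S (mkseq sigma m)| : R) @ \oo --> (0 : R).

(* Main.v *)
(** With the norm defined by P, the S_k are contractions; let E_w be the subspace
of the vectors whose norm the product along the word w preserves. If a nonzero
subspace of E_w is stable under that product, the product restricted to it has
determinant 1 or -1, so its spectral radius is at least 1.

Assume rho < 1 for the words of length at most 4. Then E_(kkk) = 0, because the
dimensions of E_k, E_(kk), E_(kkk) decrease strictly from 2. Hence a word of
length 9 that preserves the norm of some x <> 0 has no three equal consecutive
letters, and both factors 12 and 21 recur in it within 4 steps. If E_(12) or
E_(21) is a line, the trajectory of x returns to this line after at most 4
steps, which gives a stable line. Otherwise E_(12) = E_1 and E_(21) = E_2 are
planes, so S_1 maps E_1 into E_2, S_2 maps E_2 into E_1, and E_1 is stable under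
S_2 S_1. Both cases are impossible, so by compactness all products of length 9
are strict contractions for a common ratio.

Everything is written for row vectors, acted on from the right by the S_k^T. *)

Require Import Defs.
From mathcomp Require Import all_boot all_order all_algebra.
From mathcomp Require Import all_classical all_reals all_analysis.
From mathcomp Require Import complex ring lra zify.

Import Order.TTheory GRing.Theory Num.Theory.
Import numFieldNormedType.Exports.
Local Open Scope classical_set_scope.
Local Open Scope ring_scope.
Set Implicit Arguments.
Unset Strict Implicit.
Unset Printing Implicit Defensive.

(** * Complex eigenvalues of a real matrix *)

Section SpectralRadius.
Context (R : realType).
Local Notation normc := (@ComplexField.Normc.normc R).
Local Notation cmx := (map_mx (real_complex R)).

Lemma normc_ge0 (z : R[i]) : 0 <= normc z.
Proof. by case: z => a b; apply: sqrtr_ge0. Qed.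

Lemma normcX (z : R[i]) k : normc (z ^+ k) = normc z ^+ k.
Proof.
elim: k => [|k IH]; first by rewrite !expr0 ComplexField.Normc.normc1.
by rewrite !exprS ComplexField.Normc.normcM IH.
Qed.

Lemma normc_real (x : R) : normc (real_complex R x) = `|x|.
Proof. by rewrite /= expr0n /= addr0 sqrtr_sqr. Qed.

Lemma normc_opp (z : R[i]) : normc (- z) = normc z.
Proof. by case: z => a b /=; rewrite !sqrrN. Qed.

Lemma ler_normc_sum (I : Type) (r : seq I) (F : I -> R[i]) :
  normc (\sum_(i <- r) F i) <= \sum_(i <- r) normc (F i).
Proof.
elim: r => [|i r IH]; first by rewrite !big_nil ComplexField.Normc.normc0.
rewrite !big_cons; apply: le_trans (lerD (lexx _) IH).
exact: (le_normcD (F i)).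
Qed.

Lemma char_poly_roots n (A : 'M[R[i]]_n) :
  exists2 s : seq R[i], size s = n & char_poly A = \prod_(z <- s) ('X - z%:P).
Proof.
have [s] := closed_field_poly_normal (char_poly A).
rewrite (monicP (char_poly_monic A)) scale1r => Es.
exists s => //; have := size_char_poly A.
by rewrite Es size_prod_XsubC => -[].
Qed.

Definition eigval_lt1 n (A : 'M[R]_n) :=
  forall z, eigenvalue (cmx A) z -> normc z < 1.

Lemma spectral_radius_lt1 n (A : 'M[R]_n) :
  spectral_radius A < 1 <-> eigval_lt1 A.
Proof.
rewrite /spectral_radius; set E := [set _ | _ in _].
have [s _ Es] := char_poly_roots (cmx A).
have ins z : eigenvalue (cmx A) z -> z \in s.
  by rewrite eigenvalue_root_char Es root_prod_XsubC.
split=> [lt1 z ez|lt1].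
  apply: le_lt_trans lt1; apply: ub_le_sup; last by exists z.
  exists (\big[Num.max/0]_(y <- s) normc y) => _ [y ey <-].
  exact/le_bigmax_seq/isT/ins.
(* If there is no eigenvalue, [sup] takes its default value 0 on the empty set. *)
have [E0|/nonemptyPn->] := pselect (E !=set0); last by rewrite sup0 ltr01.
apply: le_lt_trans
  (_ : \big[Num.max/0]_(y <- s | normc y < 1) normc y < 1).
  apply: ge_sup E0 _ => _ [y ey <-].
  by apply: le_bigmax_seq; [apply: ins | apply: lt1].
by apply: bigmax_lt => //; rewrite ltr01.
Qed.

Lemma eigval_lt1_tr n (A : 'M[R]_n) : eigval_lt1 A -> eigval_lt1 A^T.
Proof.
move=> A1 z; rewrite eigenvalue_root_char => z_root; apply: A1.
rewrite eigenvalue_root_char; congr (root _ z): z_root.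
rewrite -map_trmx /char_poly -[RHS]det_tr; congr (\det _).
by apply/matrixP=> i j; rewrite !mxE eq_sym.
Qed.

(** Up to sign the determinant is the product of the complex eigenvalues. As [0 < d] there is a
    first factor, below 1, and the others are at most 1. *)
Lemma norm_det_lt1 d (B : 'M[R]_d) :
  (0 < d)%N -> eigval_lt1 B -> `|\det B| < 1.
Proof.
move=> d_gt0 B1; have [s sz_s Es] := char_poly_roots (cmx B).
have s1 z : z \in s -> normc z < 1.
  by move=> zs; apply: B1; rewrite eigenvalue_root_char Es root_prod_XsubC.
have -> : `|\det B| = \prod_(z <- s) normc z.
  have := char_poly_det (cmx B); rewrite Es -horner_coef0 horner_prod.
  move/(congr1 normc); rewrite det_map_mx ComplexField.Normc.normcM.
  rewrite normcX normc_opp ComplexField.Normc.normc1 expr1n mul1r normc_real => <-.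
  rewrite (big_morph _ (@ComplexField.Normc.normcM R)
                       (ComplexField.Normc.normc1 R)).
  by apply: eq_bigr => z _; rewrite hornerXsubC sub0r normc_opp.
case: s sz_s s1 {Es} => [sz0|z s _ s1]; first by rewrite -sz0 in d_gt0.
rewrite big_cons; apply: le_lt_trans (s1 z (mem_head _ _)).
rewrite ler_piMr ?normc_ge0 // big_seq.
apply: Num.Theory.prodr_ile1 => y ys.
by rewrite normc_ge0 ltW // s1 // in_cons ys orbT.
Qed.

End SpectralRadius.

(** * Contractions for a quadratic form *)

Section QuadraticForm.
Context (R : realType) (n : nat).
Implicit Types (P D M N : 'M[R]_n) (x y : 'rV[R]_n).

Definition qform P x : R := (x *m P *m x^T) ord0 ord0.

Lemma qform0 P : qform P 0 = 0.
Proof. by rewrite /qform !mul0mx mxE. Qed.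

Lemma qformMr P M x : qform P (x *m M) = qform (M *m P *m M^T) x.
Proof. by rewrite /qform trmx_mul !mulmxA. Qed.

Lemma qformB P Q x : qform (P - Q) x = qform P x - qform Q x.
Proof. by rewrite /qform mulmxBr mulmxBl !mxE. Qed.

Lemma qformZ P t x : qform P (t *: x) = t ^+ 2 * qform P x.
Proof.
by rewrite /qform linearZ /= -!scalemxAl -scalemxAr scalerA mxE expr2.
Qed.

(* Otherwise [qform D] would be negative at [x D + t x] for some [t]. *)
Lemma qform_psd_eq0 D x : D^T = D -> (forall y, 0 <= qform D y) ->
  qform D x = 0 -> x *m D = 0.
Proof.
move=> Dsym D_ge0 Dx0; have [y yE] : exists y, y = x *m D by exists (x *m D).
rewrite -yE.
pose b := \sum_j y ord0 j ^+ 2.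
have xDy : x *m D *m y^T = b%:M.
  apply/matrixP=> i j; rewrite !ord1 !mxE eqxx mulr1n /b.
  by apply: eq_bigr => k _; rewrite -yE [_^T _ _]mxE expr2.
have yDx : y *m D *m x^T = b%:M.
  by rewrite -[RHS]tr_scalar_mx -xDy !trmx_mul trmxK Dsym mulmxA.
have xDx : x *m D *m x^T = 0.
  by apply/matrixP=> i j; rewrite !ord1 [RHS]mxE; exact: Dx0.
have quad t : 0 <= qform D y + t * (b *+ 2).
  have := D_ge0 (y + t *: x); rewrite /qform linearD linearZ /= mulmxDl mulmxDr.
  rewrite !mulmxDl -!scalemxAl -!scalemxAr yDx xDy.
  rewrite xDx !scaler0 addr0 -addrA -scalerDl scale_scalar_mx.
  by move: (y *m D *m y^T) => Y; rewrite !mxE eqxx -mulr2n mulrnAl -mulrnAr.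
have b0 : b = 0.
  have [//|b_neq0] := eqVneq b 0.
  (* For this value of [t] the inequality [quad] reads [0 <= -1]. *)
  have := quad (- (qform D y + 1) / (b *+ 2)).
  by rewrite divfK ?mulrn_eq0 // ; lra.
apply/rowP=> j; rewrite [RHS]mxE; apply/eqP; rewrite -sqrf_eq0; apply/eqP.
by apply: (psumr_eq0P _ b0) => // k _; apply: sqr_ge0.
Qed.

Definition qcontraction P M := forall x, qform P (x *m M) <= qform P x.

Lemma qcontraction1 P : qcontraction P 1%:M.
Proof. by move=> x; rewrite mulmx1. Qed.

Lemma qcontractionM P M N :
  qcontraction P M -> qcontraction P N -> qcontraction P (M *m N).
Proof. by move=> PM PN x; rewrite mulmxA; apply: le_trans (PN _) (PM x). Qed.

(* For a contraction [M] the row space of this matrix is the set of the row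
   vectors [x] with [qform P (x *m M) = qform P x], see [isometric_mxP]. *)
Definition isometric_mx P M := kermx (P - M *m P *m M^T).

Lemma isometric_mxP P M x : P^T = P -> qcontraction P M ->
  (x <= isometric_mx P M)%MS <-> qform P (x *m M) = qform P x.
Proof.
move=> Psym PM; split=> [/sub_kermxP xD|eqPM].
  apply/esym/eqP; rewrite -subr_eq0 qformMr -qformB /qform xD.
  by rewrite mul0mx mxE.
apply/sub_kermxP/qform_psd_eq0 => [|y|].
- by rewrite linearB /= !trmx_mul trmxK Psym mulmxA.
- by rewrite qformB -qformMr subr_ge0.
- by rewrite qformB -qformMr eqPM subrr.
Qed.

(** The form decreases weakly from [x] to [x *m M] to [x *m M *m N], so its end values agree exactly
    when both steps preserve it. *)
Lemma isometric_mxM P M N x : P^T = P -> qcontraction P M -> qcontraction P N ->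
  (x <= isometric_mx P (M *m N))%MS =
  (x <= isometric_mx P M)%MS && (x *m M <= isometric_mx P N)%MS.
Proof.
move=> Psym PM PN; have PMN := qcontractionM PM PN.
apply/idP/andP=> [/(isometric_mxP _ Psym PMN)|[]]; rewrite ?mulmxA.
  move=> eqMN; have := PN (x *m M); rewrite eqMN => leM.
  have eqM : qform P (x *m M) = qform P x by apply: le_anti; rewrite PM leM.
  by split; apply/isometric_mxP; rewrite ?eqMN ?eqM.
move=> /(isometric_mxP _ Psym PM) eqM /(isometric_mxP _ Psym PN) eqN.
by apply/isometric_mxP; rewrite // mulmxA eqN.
Qed.

End QuadraticForm.

(** * Stable subspaces of vectors whose norm is preserved *)

Section InvariantIsometry.
Context (R : realType) (n : nat) (P : 'M[R]_n).
Hypotheses (Psym : P^T = P) (Ppos : forall x : 'rV[R]_n, x != 0 -> 0 < qform P x).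

(* The restriction of [M] to [U] preserves a positive definite form, so its
   determinant is [1] or [-1], and its eigenvalues are eigenvalues of [M]. *)
Lemma isometric_stable_eq0 m (M : 'M[R]_n) (U : 'M[R]_(m, n)) :
  eigval_lt1 M -> (U <= isometric_mx P M)%MS -> (U *m M <= U)%MS -> U = 0.
Proof.
move=> M1 UK UM; apply/eqP; rewrite -mxrank_eq0 -leqn0 leqNgt.
apply/negP=> rankU_gt0.
have [V V_free eqVU] : {V : 'M[R]_(\rank U, n) | row_free V & (V :=: U)%MS}.
  exists (row_base U); [apply: row_base_free | apply: eq_row_base].
have VM : (V *m M <= V)%MS.
  by rewrite (eqmxMr M eqVU) (submx_trans UM) ?eqVU.
have [B BV] := submxP VM.
have B1 : eigval_lt1 B.
  move=> z /eigenvalueP[v vB v_neq0]; apply: M1; apply/eigenvalueP.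
  pose C := map_mx (real_complex R); exists (v *m C _ _ V).
    by rewrite -mulmxA -map_mxM BV map_mxM mulmxA vB scalemxAl.
  apply: contraNneq v_neq0 => vV0; apply/eqP.
  by apply: (row_free_inj (_ : row_free (C _ _ V))); rewrite ?row_free_map ?mul0mx.
(* [G] is the Gram matrix of the basis [V]. Isometry reads [G = B *m G *m B^T], and [\det G] cancels
   because [P] is definite. *)
pose G := V *m P *m V^T.
have GE : G = B *m G *m B^T.
  have /sub_kermxP : (V <= isometric_mx P M)%MS by rewrite eqVU.
  move/(congr1 (mulmx^~ V^T)); rewrite mulmxBr mulmxBl mul0mx => /subr0_eq.
  rewrite -/G => {1}->; rewrite /G !mulmxA -BV.
  by rewrite -[RHS]mulmxA -trmx_mul -BV trmx_mul !mulmxA.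
have G_unit : G \in unitmx.
  rewrite -row_free_unit -kermx_eq0; apply/rowV0P=> v /sub_kermxP vG.
  apply: (row_free_inj V_free); rewrite mul0mx; apply/eqP/contraT => /Ppos.
  by rewrite /qform trmx_mul !mulmxA -2!(mulmxA v) -/G vG mul0mx mxE ltxx.
have detB : (\det B) ^+ 2 = 1.
  apply: (mulIf (_ : \det G != 0)); first by rewrite -unitfE -unitmxE.
  by rewrite {2}GE !det_mulmx det_tr; ring.
have := norm_det_lt1 rankU_gt0 B1.
by rewrite -(expr_lt1 (n := 2)) // real_normK ?num_real // detB ltxx.
Qed.

(* The isometric subspaces of the powers of [M] decrease; as soon as two
   consecutive ones agree they are [M]-stable, hence zero. *)
Lemma rank_isometric_mxX M k : qcontraction P M -> eigval_lt1 M ->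
  (\rank (isometric_mx P (iter k (mulmx M) 1%:M)) <= n - k)%N.
Proof.
move=> PM M1; set K := fun k => isometric_mx P (iter k (mulmx M) 1%:M).
have PMk j : qcontraction P (iter j (mulmx M) 1%:M).
  elim: j => [|j IH] /=; [exact: qcontraction1 | exact: qcontractionM].
(* Splitting off the last factor gives [K k.+1 <= K k]; splitting off the first one shows that [M]
   maps [K k.+1] into [K k]. *)
have iterSr j : iter j.+1 (mulmx M) 1%:M = iter j (mulmx M) 1%:M *m M.
  elim: j => [|j IH]; first by rewrite /= mulmx1 mul1mx.
  by rewrite [LHS]iterS {1}IH mulmxA.
elim: k => [|k IH]; first by rewrite subn0 rank_leq_row.
have leK : (K k.+1 <= K k)%MS.
  by apply/rV_subP=> x; rewrite /K iterSr isometric_mxM // => /andP[].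
have [leK'|] := boolP (K k <= K k.+1)%MS.
  suff -> : isometric_mx P (iter k.+1 (mulmx M) 1%:M) = 0 by rewrite mxrank0.
  apply: (isometric_stable_eq0 M1).
    by apply/rV_subP=> x; rewrite iterS isometric_mxM // => /andP[].
  apply: submx_trans leK'; apply/row_subP=> i; rewrite row_mul.
  have := row_sub i (K k.+1); move: (row i _) => x.
  by rewrite {1}/K iterS isometric_mxM // => /andP[].
move=> ltK; have /rank_ltmx : (K k.+1 < K k)%MS by rewrite ltmxE leK.
by move/leq_trans/(_ IH); rewrite /K; lia.
Qed.

End InvariantIsometry.

(** * Products along words, and patterns in words of length 9 *)

Section Words.
Context (R : realType) (n : nat).

(** On row vectors the leftmost factor acts first, so the letters are in reading order;
    [word_prod_tr] is the link with [word_prod]. *)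
Fixpoint path_mx (I : Type) (T : I -> 'M[R]_n) (w : seq I) : 'M[R]_n :=
  if w is i :: w' then T i *m path_mx T w' else 1%:M.

Lemma path_mx_cat (I : Type) (T : I -> 'M[R]_n) u v :
  path_mx T (u ++ v) = path_mx T u *m path_mx T v.
Proof. by elim: u => [|i u IH] /=; rewrite ?mul1mx // IH mulmxA. Qed.

Lemma path_mx_map (I J : Type) (f : I -> J) (T : J -> 'M[R]_n) w :
  path_mx T (map f w) = path_mx (T \o f) w.
Proof. by elim: w => //= i w ->. Qed.

Lemma path_mx_nseq (I : Type) (T : I -> 'M[R]_n) k i :
  path_mx T (nseq k i) = iter k (mulmx (T i)) 1%:M.
Proof. by elim: k => //= k ->. Qed.

Lemma word_prod_tr (I : Type) (S : I -> 'M[R]_n) w :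
  (word_prod S w)^T = path_mx (fun i => (S i)^T) w.
Proof.
suff acc (B : 'M[R]_n) : (foldl (fun B i => S i *m B) B w)^T =
    B^T *m path_mx (fun i => (S i)^T) w by rewrite acc trmx1 mul1mx.
by elim: w B => [|i w IH] B /=; rewrite ?mulmx1 // IH trmx_mul mulmxA.
Qed.

Lemma qcontraction_path (I : Type) (T : I -> 'M[R]_n) P w :
  (forall i, qcontraction P (T i)) -> qcontraction P (path_mx T w).
Proof.
move=> PT; elim: w => [|i w IH] /=; first exact: qcontraction1.
exact: qcontractionM.
Qed.

End Words.

(* Without three equal letters in a row, a run of [~~ c] and a run of [c] lie
   between two consecutive factors [c; ~~ c], which are thus 2 to 4 apart. *)
Definition recurs (c : bool) (w : seq bool) :=
  has (fun i => has (fun d =>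
    [&& 0 < size (take d (drop i w)) <= 4,
        take 2 (drop i w) == [:: c; ~~ c] &
        take 2 (drop (i + d) w) == [:: c; ~~ c]]%N) [:: 2; 3; 4]%N) (iota 0 9).

(** Checked by computation on all 512 words. *)
Lemma run3_or_recurs (w : seq bool) : size w = 9 ->
  has (fun i => has (fun a => take 3 (drop i w) == nseq 3 a) [:: true; false])
    (iota 0 9) || recurs true w && recurs false w.
Proof.
by case: w => [|a1 [|a2 [|a3 [|a4 [|a5 [|a6 [|a7 [|a8 [|a9 [|]]]]]]]]]] // _;
  case: a1 a2 a3 a4 a5 a6 a7 a8 a9 => [] [] [] [] [] [] [] [] [].
Qed.

(** * Trajectories of constant norm *)

Section IsometricPaths.
Context (R : realType) (n : nat) (P : 'M[R]_n) (I : Type) (T : I -> 'M[R]_n).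
Hypotheses (Psym : P^T = P) (PT : forall i, qcontraction P (T i)).
Implicit Types (w : seq I) (x : 'rV[R]_n).

Local Notation K := (isometric_mx P).

Lemma isometric_path_cat u w x :
  (x <= K (path_mx T (u ++ w)))%MS =
  (x <= K (path_mx T u))%MS && (x *m path_mx T u <= K (path_mx T w))%MS.
Proof.
by rewrite path_mx_cat (isometric_mxM _ Psym) //; apply: qcontraction_path.
Qed.

Lemma isometric_path_sub w x i d : (x <= K (path_mx T w))%MS ->
  (x *m path_mx T (take i w) <= K (path_mx T (take d (drop i w))))%MS.
Proof.
rewrite -{1}(cat_take_drop i w) isometric_path_cat => /andP[_].
by rewrite -{1}(cat_take_drop d (drop i w)) isometric_path_cat => /andP[].
Qed.

(** After [i] letters the form still has its initial value, which is positive. *)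
Lemma isometric_path_neq0 w x i : (forall y : 'rV[R]_n, y != 0 -> 0 < qform P y) ->
  x != 0 -> (x <= K (path_mx T w))%MS -> x *m path_mx T (take i w) != 0.
Proof.
move=> Ppos x_neq0; rewrite -{1}(cat_take_drop i w) isometric_path_cat.
move=> /andP[/(isometric_mxP _ Psym (qcontraction_path _ PT)) eqP _].
by apply: contraTneq (Ppos x x_neq0) => x0; rewrite -eqP x0 qform0 ltxx.
Qed.

End IsometricPaths.

(** * Dimension three: words of length 9 preserve no nonzero vector *)

Section ThreeDimensional.
Context (R : realType) (P : 'M[R]_3) (T : bool -> 'M[R]_3).
Hypotheses (Psym : P^T = P) (Ppos : forall x : 'rV[R]_3, x != 0 -> 0 < qform P x).
Hypothesis PT : forall c, qcontraction P (T c).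
Hypothesis T1 : forall w, (0 < size w <= 4)%N -> eigval_lt1 (path_mx T w).

Local Notation K := (isometric_mx P).

(* The trajectory of [x] comes back to the same isometric line. *)
Lemma recurs_eq0 c w (x : 'rV_3) :
  (\rank (K (path_mx T [:: c; ~~ c])) <= 1)%N -> recurs c w ->
  (x <= K (path_mx T w))%MS -> x = 0.
Proof.
move=> rank1 /hasP[i _ /hasP[d _ /and3P[sz_d /eqP wi /eqP wid]]] xw.
apply/eqP/contraT => x_neq0; have := isometric_path_neq0 Psym PT i Ppos x_neq0 xw.
set y := x *m _ => y_neq0.
suff y0 : y = 0 by rewrite y0 eqxx in y_neq0.
have yF : (y <= K (path_mx T [:: c; ~~ c]))%MS.
  by rewrite -wi; apply: isometric_path_sub.
(* A nonzero vector of a space of rank at most 1 spans it. *)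
have Fy : (K (path_mx T [:: c; ~~ c]) <= y)%MS.
  rewrite -(mxrank_leqif_sup yF) eqn_leq mxrankS // (leq_trans rank1) //.
  by rewrite lt0n mxrank_eq0 y_neq0.
apply: (isometric_stable_eq0 Ppos (T1 sz_d)).
  exact: isometric_path_sub.
(* The image of [y] after [d] letters is the vector reached after [i + d] letters, where the factor
   [[:: c; ~~ c]] starts again. *)
apply: submx_trans Fy; rewrite /y -mulmxA -path_mx_cat -takeD -wid.
exact: isometric_path_sub.
Qed.

Lemma isometric_path9_eq0 w (x : 'rV_3) : size w = 9 ->
  (x <= K (path_mx T w))%MS -> x = 0.
Proof.
move=> sz_w xw; apply/eqP/contraT => x_neq0.
have T1' c : eigval_lt1 (T c) by have := @T1 [:: c] isT; rewrite /= mulmx1.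
have /orP[/hasP[i _ /hasP[a _ /eqP wi]]|/andP[rec_t rec_f]] :=
    run3_or_recurs sz_w.
  (* On a run of three equal letters the rank bound is [3 - 3 = 0]. *)
  have := isometric_path_sub Psym PT i 3 xw; rewrite wi path_mx_nseq.
  have := rank_isometric_mxX Psym Ppos 3 (PT a) (T1' a).
  rewrite subnn leqn0 mxrank_eq0 => /eqP->; rewrite submx0 => /eqP y0.
  by have := isometric_path_neq0 Psym PT i Ppos x_neq0 xw; rewrite y0 eqxx.
pose F c := K (path_mx T [:: c; ~~ c]).
have rec c : recurs c w by case: c.
have rankF c : (1 < \rank (F c))%N.
  rewrite ltnNge; apply/negP=> rank1.
  by rewrite (recurs_eq0 rank1 (rec c) xw) eqxx in x_neq0.
have FE c (z : 'rV_3) : (z <= F c)%MS = (z <= K (T c))%MS && (z *m T c <= K (T (~~ c)))%MS.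
  by rewrite /F /= mulmx1 isometric_mxM.
have leF c : (F c <= K (T c))%MS by apply/rV_subP=> z; rewrite FE => /andP[].
(* [K (T c)] has rank at most 2 and its subspace [F c] at least 2, so they coincide. *)
have KF c : (K (T c) <= F c)%MS.
  rewrite -(mxrank_leqif_sup (leF c)) eqn_leq mxrankS // (leq_trans _ (rankF c)) //.
  by have := rank_isometric_mxX Psym Ppos 1 (PT c) (T1' c); rewrite /= mulmx1.
have KT c (z : 'rV_3) : (z <= K (T c))%MS -> (z *m T c <= K (T (~~ c)))%MS.
  by move/submx_trans/(_ (KF c)); rewrite FE => /andP[].
suff K0 : K (T true) = 0
  by have := leq_trans (rankF true) (mxrankS (leF true)); rewrite K0 mxrank0.
(* By [KT] used twice, [T true] followed by [T false] maps [K (T true)] into itself. *)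
apply: (isometric_stable_eq0 Ppos (@T1 [:: true; false] isT)) => //.
apply/row_subP=> i; rewrite row_mul /= mulmx1 mulmxA.
exact/(KT false)/(KT true)/row_sub.
Qed.

End ThreeDimensional.

Lemma ler_mx_entry (R : realType) m n (A : 'M[R]_(m, n)) i j :
  `|A i j| <= `|A|.
Proof.
rewrite [leRHS]mx_normrE.
exact: (@le_bigmax _ _ _ _ (fun ij => `|A ij.1 ij.2|) (i, j)).
Qed.

(** * Compactness of the unit sphere and uniform contraction ratios *)

Section Compactness.
Context (R : realType) (n : nat).
Implicit Types (P D M : 'M[R]_n) (x : 'rV[R]_n).

Lemma continuous_sum (U : topologicalType) (I : Type) (r : seq I)
    (F : I -> U -> R) :
  (forall i, continuous (F i)) -> continuous (fun u => \sum_(i <- r) F i u).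
Proof.
move=> cF u; elim: r => [|i r IH].
  by under eq_fun do rewrite big_nil; apply: cst_continuous.
by under eq_fun do rewrite big_cons; apply: continuousD; [apply: cF | apply: IH].
Qed.

Lemma qform_continuous D : continuous (qform D).
Proof.
have -> : qform D = fun x => \sum_j (\sum_i x ord0 i * D i j) * x ord0 j.
  apply/funext=> x; rewrite /qform mxE; apply: eq_bigr => j _.
  by rewrite !mxE.
apply: continuous_sum => j x.
apply: continuousM; last exact: coord_continuous.
apply: continuous_sum => i {}x.
by apply: continuousM; [exact: coord_continuous | exact: cst_continuous].
Qed.

Lemma compact_sphere : compact [set x : 'rV[R]_n | `|x| = 1].
Proof.
apply: bounded_closed_compact.
  by exists 1; split=> // M M_gt1 x /= ->; apply: ltW.
apply: (@preimage_closed _ _ (@Num.norm _ 'rV[R]_n) [set y | y = 1]).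
  by move=> x _; apply: norm_continuous.
exact: closed_eq.
Qed.

Lemma qform_normalize D x : x != 0 ->
  qform D x = `|x| ^+ 2 * qform D (`|x|^-1 *: x).
Proof.
move=> x_neq0; rewrite qformZ mulrA -exprMn divff ?normr_eq0 //.
by rewrite expr1n mul1r.
Qed.

(** By homogeneity the minimum on the unit sphere serves as [c]; if the sphere is empty, 0 is the
    only vector. *)
Lemma qform_lower_bound D : (forall x, x != 0 -> 0 < qform D x) ->
  exists2 c, 0 < c & forall x, c * `|x| ^+ 2 <= qform D x.
Proof.
move=> Dpos; have [A0|/nonemptyPn A0] := pselect ([set x : 'rV[R]_n | `|x| = 1] !=set0).
  have [|x0] := EVT_min_rV (f := qform D) A0 compact_sphere.
    by apply: continuous_subspaceT; apply: qform_continuous.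
  rewrite inE /= => nx0 minx0; exists (qform D x0).
    by apply: Dpos; rewrite -normr_eq0 nx0 oner_eq0.
  move=> x; have [->|x_neq0] := eqVneq x 0.
    by rewrite normr0 expr0n mulr0 qform0.
  rewrite (qform_normalize D x_neq0) mulrC ler_wpM2l ?sqr_ge0 //.
  by apply: minx0; rewrite inE /= normfZV.
exists 1 => // x; have [->|x_neq0] := eqVneq x 0.
  by rewrite normr0 expr0n mulr0 qform0.
by have : set0 (`|x|^-1 *: x) by rewrite -A0 /= normfZV.
Qed.

Lemma qform_upper_bound D :
  exists2 c, 0 < c & forall x, qform D x <= c * `|x| ^+ 2.
Proof.
have [A0|/nonemptyPn A0] := pselect ([set x : 'rV[R]_n | `|x| = 1] !=set0).
  have [|x0] := EVT_max_rV (f := qform D) A0 compact_sphere.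
    by apply: continuous_subspaceT; apply: qform_continuous.
  rewrite inE /= => nx0 maxx0; exists (`|qform D x0| + 1); first by rewrite ltr_wpDl.
  move=> x; have [->|x_neq0] := eqVneq x 0.
    by rewrite normr0 expr0n mulr0 qform0.
  rewrite (qform_normalize D x_neq0) mulrC ler_wpM2r ?sqr_ge0 //.
  apply: le_trans (maxx0 _ _) _; first by rewrite inE /= normfZV.
  by rewrite (le_trans (ler_norm _)) // lerDl.
exists 1 => // x; have [->|x_neq0] := eqVneq x 0.
  by rewrite normr0 expr0n mulr0 qform0.
by have : set0 (`|x|^-1 *: x) by rewrite -A0 /= normfZV.
Qed.

Lemma strict_contraction P M : P^T = P -> qcontraction P M ->
  (forall x, (x <= isometric_mx P M)%MS -> x = 0) ->
  exists2 g, 0 <= g < 1 & forall x, qform P (x *m M) <= g * qform P x.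
Proof.
move=> Psym PM K0.
have [x x_neq0|c c_gt0 cD] := @qform_lower_bound (P - M *m P *m M^T).
  rewrite qformB -qformMr subr_gt0 lt_neqAle PM andbT.
  apply: contra_neq x_neq0 => eqP; apply: K0.
  exact/isometric_mxP.
have [C C_gt0 CP] := qform_upper_bound P.
have cC_gt0 : 0 < C + c by apply: addr_gt0.
(* The two bounds give [c P <= C D] for the defect [D], hence a fortiori [c P <= (C + c) D]; the
   larger denominator keeps the ratio nonnegative. *)
exists (1 - c / (C + c)).
  rewrite subr_ge0 ler_pdivrMr // mul1r lerDr ltW //=.
  by rewrite ltrBlDr ltrDl divr_gt0.
move=> x; have := cD x; rewrite qformB -qformMr => le_cD.
rewrite mulrBl mul1r lerBrDr -lerBrDl; apply: le_trans le_cD.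
rewrite mulrAC ler_pdivrMr // -mulrA ler_pM2l // mulrC.
apply: le_trans (CP x) _; rewrite ler_wpM2r ?sqr_ge0 //.
by rewrite lerDl ltW.
Qed.

End Compactness.

(** * Decay of products by blocks, and eigenvalues of periodic products *)

Section Stability.
Context (R : realType) (n : nat).
Implicit Types (P : 'M[R]_n) (x : 'rV[R]_n).
Local Notation normc := (@ComplexField.Normc.normc R).

Lemma mkseqD (I : Type) (f : nat -> I) m k :
  mkseq f (m + k) = mkseq f m ++ mkseq (fun i => f (m + i)%N) k.
Proof. by rewrite /mkseq iotaD map_cat add0n -[in iota m k](addn0 m) iotaDl -map_comp. Qed.

(** Each full block of [L] letters gains a factor [g], and the remaining [m %% L] letters do not
    increase the form. *)
Lemma qform_path_decay (I : Type) (T : I -> 'M[R]_n) P L g (s : nat -> I) m x :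
  0 <= g -> (forall i, qcontraction P (T i)) ->
  (forall w x, size w = L -> qform P (x *m path_mx T w) <= g * qform P x) ->
  qform P (x *m path_mx T (mkseq s m)) <= g ^+ (m %/ L) * qform P x.
Proof.
move=> g_ge0 PT block.
have mult k u : qform P (x *m path_mx T (mkseq u (k * L))) <= g ^+ k * qform P x.
  elim: k u => [|k IH] u; first by rewrite mul0n expr0 mul1r mulmx1.
  rewrite mulSnr mkseqD path_mx_cat mulmxA.
  apply: le_trans (block _ _ _) _; first by rewrite size_mkseq.
  by rewrite exprS -mulrA ler_wpM2l.
rewrite {1}(divn_eq m L) mkseqD path_mx_cat mulmxA.
exact: le_trans (qcontraction_path _ PT _) (mult _ _).
Qed.

Lemma absolutely_stable_of_blocks (I : Type) (S : I -> 'M[R]_n) P L g :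
  (0 < L)%N -> 0 <= g < 1 -> (forall x, x != 0 -> 0 < qform P x) ->
  (forall i, qcontraction P (S i)^T) ->
  (forall w x, size w = L ->
    qform P (x *m path_mx (fun i => (S i)^T) w) <= g * qform P x) ->
  absolutely_stable S.
Proof.
move=> L_gt0 /andP[g_ge0 g_lt1] Ppos PT block s.
have [c c_gt0 cP] := qform_lower_bound Ppos.
have P_ge0 x : 0 <= qform P x.
  by apply: le_trans (cP x); rewrite mulr_ge0 ?sqr_ge0 // ltW.
(* Summing over the standard basis makes the bound independent of the entry where the norm of the
   product is attained. *)
pose B := \sum_(i < n) qform P (row i 1%:M).
have entry m : c * `|word_prod S (mkseq s m)| ^+ 2 <= g ^+ (m %/ L) * B.
  set A := word_prod _ _; have [->|A_neq0] := eqVneq (`|A|) 0.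
    by rewrite expr0n mulr0 mulr_ge0 ?exprn_ge0 // sumr_ge0.
  have [[i j] /= AE] := mx_norm_neq0 A_neq0; rewrite (AE : `|A| = _).
  pose x : 'rV[R]_n := row j 1%:M.
  have Aij : A i j = (x *m A^T) ord0 i by rewrite /x -row_mul mul1mx !mxE.
  have leA : `|A i j| <= `|x *m A^T|.
    by rewrite Aij ler_mx_entry.
  apply: (@le_trans _ _ (qform P (x *m A^T))).
    by apply: le_trans (cP _); rewrite ler_pM2l // lerXn2r ?nnegrE.
  rewrite word_prod_tr; apply: le_trans (qform_path_decay _ _ _ g_ge0 PT block) _.
  by rewrite ler_wpM2l ?exprn_ge0 // /B (bigD1 j) //= lerDl sumr_ge0.
apply/cvgr0Pnorm_lt => e e_gt0.
have ce_gt0 : 0 < c * e ^+ 2 by rewrite mulr_gt0 ?exprn_gt0.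
have /cvgr0_norm_lt/(_ _ ce_gt0)[N _ ltN] : geometric B g @ \oo --> 0.
  by apply: cvg_geometric; rewrite ger0_norm.
(* From [N * L] letters on, at least [N] full blocks have been read. *)
exists (N * L)%N => // m /= le_m; rewrite normr_id.
have := ltN (m %/ L)%N; rewrite /= leq_divRL // => /(_ le_m) /(le_lt_trans (ler_norm _)).
rewrite mulrC => /(le_lt_trans (entry m)); rewrite ltr_pM2l //.
by rewrite ltr_pXn2r // nnegrE ?normr_ge0 // ltW.
Qed.

Lemma word_prod_flatten (I : Type) (S : I -> 'M[R]_n) w k :
  word_prod S (flatten (nseq k w)) = iter k (mulmx (word_prod S w)) 1%:M.
Proof.
apply: trmx_inj; rewrite word_prod_tr; elim: k => [|k IH] /=; first by rewrite trmx1.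
rewrite path_mx_cat IH -word_prod_tr -trmx_mul; congr (_^T).
elim: k {IH} => [|k IH] /=; first by rewrite mulmx1 mul1mx.
by rewrite -mulmxA IH.
Qed.

Lemma mkseq_periodic (I : Type) (i0 : I) (w : seq I) k :
  mkseq (fun m => nth i0 w (m %% size w)) (k * size w) = flatten (nseq k w).
Proof.
elim: k => [|k IH] //=; rewrite mulSn mkseqD -[in RHS]IH; congr (_ ++ _).
  apply: (@eq_from_nth _ i0) => [|i]; rewrite size_mkseq // => lti.
  by rewrite nth_mkseq // modn_small.
by apply: eq_mkseq => i; rewrite modnDl.
Qed.

(** If [v] is an eigenvector for [z] of modulus at least 1, the sum of the moduli of the entries of
    [v *m A ^ k] is at least that of [v], so [n] times the norm of [A ^ k] is at least 1 for every
    [k]. *)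
Lemma eigval_lt1_powers (A : 'M[R]_n) :
  (fun k => `|iter k (mulmx A) 1%:M| : R) @ \oo --> (0 : R) -> eigval_lt1 A.
Proof.
move=> A0 z /eigenvalueP[v vA v_neq0]; rewrite ltNge; apply/negP=> z_ge1.
pose norm1 := \sum_j normc (v ord0 j).
have norm1_gt0 : 0 < norm1.
  rewrite lt_neqAle sumr_ge0 ?andbT => [|j _]; last exact: normc_ge0.
  apply: contraNneq v_neq0 => /esym/eqP; rewrite psumr_eq0 => [|j _]; last exact: normc_ge0.
  move/allP=> v0; apply/eqP/rowP=> j; rewrite mxE.
  by apply/ComplexField.Normc.eq0_normc/eqP/v0; rewrite mem_index_enum.
have vAk k : v *m map_mx (real_complex R) (iter k (mulmx A) 1%:M) = z ^+ k *: v.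
  elim: k => [|k IH]; first by rewrite map_mx1 mulmx1 expr0 scale1r.
  by rewrite iterS map_mxM mulmxA vA -scalemxAl IH scalerA -exprS.
have ge1 k : 1 <= n%:R * `|iter k (mulmx A) 1%:M|.
  rewrite -(ler_pM2l norm1_gt0) mulr1 mulrCA mulr_natl -[n in _ *+ n]card_ord.
  rewrite -sumr_const; apply: ler_sum => j _.
  apply: (@le_trans _ _ (normc ((z ^+ k *: v) ord0 j))).
    rewrite mxE ComplexField.Normc.normcM normcX ler_peMl ?normc_ge0 //.
    exact: exprn_ege1.
  rewrite -vAk mxE; apply: le_trans (ler_normc_sum _ _) _.
  rewrite mulr_suml; apply: ler_sum => i _.
  rewrite mxE ComplexField.Normc.normcM normc_real ler_wpM2l ?normc_ge0 //.
  exact: ler_mx_entry.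
have e_gt0 : 0 < (n.+1%:R : R)^-1 by rewrite invr_gt0 ltr0Sn.
have /cvgr0_norm_lt/(_ _ e_gt0)[N _ /(_ N (leqnn N)) /=] := A0.
rewrite normr_id -[_^-1]mul1r ltr_pdivlMr ?ltr0Sn // => lt1.
suff : (1 : R) < 1 by rewrite ltxx.
apply: le_lt_trans lt1; apply: le_trans (ge1 N) _.
by rewrite mulrC ler_wpM2l // ler_nat.
Qed.

(** Stability is applied to the periodic repetition of [w]: at the multiples of its length the
    products are the powers of [word_prod S w]. *)
Lemma absolutely_stable_eigval (I : Type) (S : I -> 'M[R]_n) (w : seq I) :
  (0 < size w)%N -> absolutely_stable S -> eigval_lt1 (word_prod S w).
Proof.
case: w => // i0 w _ Sstab; apply: eigval_lt1_powers.
have -> : (fun k => `|iter k (mulmx (word_prod S (i0 :: w))) 1%:M|) =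
  (fun m => `|word_prod S (mkseq (fun m => nth i0 (i0 :: w) (m %% size (i0 :: w))) m)|)
    \o (fun k => k * size (i0 :: w))%N.
  by apply/funext=> k; rewrite /comp mkseq_periodic word_prod_flatten.
by apply: cvg_comp (Sstab _); apply: cvg_mulnr.
Qed.

End Stability.

(** * The equivalence for two letters in dimension three *)

Theorem theoremD (R : realType) (S : 'I_2 -> 'M[R]_3)
    (hP : exists P : 'M[R]_3,
        posdefmx P /\ forall k : 'I_2, psdmx (P - (S k)^T *m P *m S k)) :
  absolutely_stable S <->
  (forall l : nat, l \in [:: 1; 2; 3; 4; 5; 6; 8]%N ->
    forall A : 'M[R]_3, products S l A -> spectral_radius A < 1).
Proof.
split=> [Sstab l l_in A [w _ <-]|rho1].
  apply/spectral_radius_lt1/absolutely_stable_eigval => //.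
  by rewrite size_tuple; case: l l_in {w}.
have {hP}[P [[Psym Pdef] Ppsd]] := hP.
have Ppos (x : 'rV[R]_3) : x != 0 -> 0 < qform P x.
  by rewrite -trmx_eq0 => /Pdef; rewrite trmxK.
have PS i : qcontraction P (S i)^T.
  move=> x; have := Ppsd i x^T; rewrite trmxK -/(qform _ x) qformB.
  by rewrite qformMr trmxK subr_ge0.
(* Letters become booleans, [false] for 0 and [true] for 1, so that [~~] exchanges them; [letter] is
   the inverse coding. *)
pose T (c : bool) := (S (inord c))^T.
pose letter (i : 'I_2) := (i : nat) == 1%N.
have pathE w : path_mx (fun i => (S i)^T) w = path_mx T (map letter w).
  rewrite path_mx_map; congr (path_mx _ _); apply/funext=> i.
  rewrite /T /=; congr ((S _)^T); apply: val_inj; rewrite /= inordK.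
    by case: i => -[|[|]].
  by case: (letter i).
have T1 w : (0 < size w <= 4)%N -> eigval_lt1 (path_mx T w).
  move=> sz_w; pose u := map (fun c : bool => inord c : 'I_2) w.
  have -> : path_mx T w = (word_prod S u)^T by rewrite word_prod_tr path_mx_map.
  apply: eigval_lt1_tr; apply/spectral_radius_lt1.
  have sz_u : size u = size w by rewrite size_map.
  apply: (rho1 (size w)).
    by move: sz_w; case: (size w) => [|[|[|[|[|]]]]].
  by exists (tcast sz_u (in_tuple u)) => //; rewrite val_tcast.
have g_ex (w : 9.-tuple bool) :
    {g : R | 0 <= g < 1 & forall x, qform P (x *m path_mx T w) <= g * qform P x}.
  apply/cid2/strict_contraction => // [|x].
    by apply: qcontraction_path => c; apply: PS.
  apply: (isometric_path9_eq0 Psym Ppos) => //; last by rewrite size_tuple.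
  by move=> c; apply: PS.
(* There are finitely many words of length 9, so the largest of their ratios is a common one and is
   still below 1. *)
pose g := \big[Num.max/0]_w s2val (g_ex w).
have gP : 0 <= g < 1.
  rewrite bigmax_ge_id /=; apply: bigmax_lt => // w _.
  by case: (g_ex w) => /= ? /andP[].
apply: (absolutely_stable_of_blocks (L := 9) _ gP Ppos PS) => // w x sz_w.
have sz_l : size (map letter w) == 9 by rewrite size_map sz_w.
rewrite pathE; apply: le_trans (s2valP' (g_ex (Tuple sz_l)) x) _.
apply: ler_wpM2r; last exact: le_bigmax.
by have [->|/Ppos/ltW//] := eqVneq x 0; rewrite qform0.
Qed.
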